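(* Let $\mathbb{K}$ be a totally ordered Archimedean field. Then the following are equivalent: (i) $\mathbb{K}$ is Cantor $\kappa$-complete for any (i.e. every) infinite cardinal $\kappa$. (ii) $\mathbb{K}$ is Leibniz complete. (iii) $\mathbb{K}$ is Heine-Borel complete. (iv) $\mathbb{K}$ is monotone complete. (v) $\mathbb{K}$ is Cantor complete (i.e. Cantor $\aleph_1$-complete, not for all cardinals). (vi) $\mathbb{K}$ is Weierstrass complete. (vii) $\mathbb{K}$ is Bolzano complete. (viii) $\mathbb{K}$ is Cauchy complete. (ix) $\mathbb{K}$ is Dedekind complete. (x) $\mathbb{K}$ is Hilbert complete.
   Context: A totally ordered field $\mathbb{K}$ carries its order topology (open intervals are the basic open sets). It contains a canonical copy of $\mathbb{Q}$ (hence of $\mathbb{N}$), and $|x|=\max(x,-x)$. $\mathbb{K}$ is Archimedean if for every $x\in\mathbb{K}$ there is $n\in\mathbb{N}$ with $|x|\le n$. For $a\le b$ in $\mathbb{K}$, $[a,b]=\{x\in\mathbb{K}:a\le x\le b\}$. F.I.P. means the finite intersection property (every finite subfamily has non-empty intersection). $\mathbb{K}_+$ is the set of positive elements of $\mathbb{K}$. Non-standard extension: fix a free (non-principal) ultrafilter $\mathcal{U}$ on $\mathbb{N}$. ${}^*\mathbb{K}=\mathbb{K}^{\mathbb{N}}/\sim$, where $(a_n)\sim(b_n)$ iff $\{n:a_n=b_n\}\in\mathcal{U}$, with the induced field operations and the order $\langle a_n\rangle<\langle b_n\rangle$ iff $\{n:a_n<b_n\}\in\mathcal{U}$; it is an ordered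 field containing $\mathbb{K}$ via constant sequences. Let $\mathcal{F}({}^*\mathbb{K})=\{x\in{}^*\mathbb{K}:|x|\le n\text{ for some }n\in\mathbb{N}\}$ (finite elements) and $\mathcal{I}({}^*\mathbb{K})=\{x\in{}^*\mathbb{K}:|x|<1/n\text{ for all }n\in\mathbb{N}\}$ with $n\geq 1$ (infinitesimals). Definitions of completeness, for a totally ordered field $\mathbb{K}$: - Cantor $\kappa$-complete: every family $\{[a_\gamma,b_\gamma]\}_{\gamma\in\Gamma}$ of fewer than $\kappa$ closed bounded intervals in $\mathbb{K}$ with the F.I.P. has non-empty intersection. - Leibniz complete: every $x\in\mathcal{F}({}^*\mathbb{K})$ can be presented uniquely in the form $x=r+dx$ with $r\in\mathbb{K}$ and $dx\in\mathcal{I}({}^*\mathbb{K})$. - Heine-Borel complete: a subset $A\subseteq\mathbb{K}$ is compact if and only if $A$ is closed and bounded. - Monotone complete: every bounded strictly increasing sequence in $\mathbb{K}$ is convergent. - Cantor complete: every nested sequence of bounded closed intervals in $\mathbb{K}$ has non-empty intersection (that is, $\mathbb{K}$ is Cantor $\aleph_1$-complete). - Weierstrass complete: every bounded sequence in $\mathbb{K}$ has a convergent subsequence. - Bolzano complete: every bounded infinite subset of $\mathbb{K}$ has a cluster point. - Cauchy complete: every fundamental $I$-net in $\mathbb{K}$ is convergent, where $I$ is a directed index set with $\mathrm{card}(I)=\mathrm{cof}(\mathbb{K})$. Here the cofinality $\mathrm{cof}(\mathbb{K})$ is the cardinality of the smallest unbounded subset of $\mathbb{K}$, and a net $f:I\to\mathbb{K}$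 on a directed set $I$ is fundamental (Cauchy) if for every $\varepsilon\in\mathbb{K}_+$ there is $h\in I$ such that $|f(i)-f(j)|<\varepsilon$ for all $i,j\in I$ with $i,j\succcurlyeq h$. - Dedekind complete: every non-empty subset of $\mathbb{K}$ that is bounded from above has a supremum in $\mathbb{K}$. - Hilbert complete (for Archimedean $\mathbb{K}$): $\mathbb{K}$ has no proper totally ordered Archimedean field extension (extension as ordered fields). *)

(* Defs.v *)
From HB Require Import structures.
From mathcomp Require Import all_boot all_order all_algebra generic_quotient.
From mathcomp Require Import all_classical all_reals all_analysis.

Set Implicit Arguments.
Unset Strict Implicit.
Unset Printing Implicit Defensive.

Import Order.TTheory GRing.Theory Num.Theory.
Import numFieldTopology.Exports.

Local Open Scope classical_set_scope.
Local Open Scope quotient_scope.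
Local Open Scope ring_scope.

(* The ultrapower *K = K^nat / U of an ordered field by an ultrafilter on nat *)

Section Ultrapower.
Variables (K : realFieldType) (U : set_system nat) (UU : UltraFilter U).

Definition ueq (f g : nat -> K) : bool := `[< U [set n | f n = g n] >].

Lemma ueq_equiv : equiv_class_of ueq.
Proof.
split.
- by move=> f; apply/asboolP; apply: filterS filterT.
- by move=> f g; apply/asboolP/asboolP; apply: filterS => n /= ->.
- move=> g f h /asboolP fg /asboolP gh; apply/asboolP.
  by apply: filterS2 fg gh => n /= ->.
Qed.

Canonical ueq_equivRel := EquivRelPack ueq_equiv.

Definition ultrapower := {eq_quot ueq_equivRel}.

HB.instance Definition _ := Choice.on ultrapower.
HB.instance Definition _ := EqQuotient.on ultrapower.

Definition uclass (f : nat -> K) : ultrapower := \pi_ultrapower f.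

Lemma uclassP f g : uclass f = uclass g <-> U [set n | f n = g n].
Proof.
by split=> [/eqP|h]; [|apply/eqP]; rewrite ?eqmodE; [move/asboolP|apply/asboolP].
Qed.

Lemma uclass_repr (x : ultrapower) : uclass (repr x) = x.
Proof. exact: reprK. Qed.

Lemma repr_uclass f : U [set n | repr (uclass f) n = f n].
Proof. by apply/uclassP; rewrite uclass_repr. Qed.

Lemma uclassW (P : ultrapower -> Prop) : (forall f, P (uclass f)) -> forall x, P x.
Proof. by move=> h x; rewrite -(uclass_repr x). Qed.

Definition uzero := uclass (fun=> 0).
Definition uone := uclass (fun=> 1).
Definition uopp (x : ultrapower) := uclass (fun n => - repr x n).
Definition uadd (x y : ultrapower) := uclass (fun n => repr x n + repr y n).
Definition umul (x y : ultrapower) := uclass (fun n => repr x n * repr y n).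
Definition uinv (x : ultrapower) := uclass (fun n => (repr x n)^-1).
Definition unorm (x : ultrapower) := uclass (fun n => `|repr x n|).
Definition ule (x y : ultrapower) := `[< U [set n | repr x n <= repr y n] >].
Definition ult (x y : ultrapower) := `[< U [set n | repr x n < repr y n] >].

Lemma uoppE f : uopp (uclass f) = uclass (fun n => - f n).
Proof. by apply/uclassP; apply: filterS (repr_uclass f) => n /= ->. Qed.

Lemma uinvE f : uinv (uclass f) = uclass (fun n => (f n)^-1).
Proof. by apply/uclassP; apply: filterS (repr_uclass f) => n /= ->. Qed.

Lemma unormE f : unorm (uclass f) = uclass (fun n => `|f n|).
Proof. by apply/uclassP; apply: filterS (repr_uclass f) => n /= ->. Qed.

Lemma uaddE f g : uadd (uclass f) (uclass g) = uclass (fun n => f n + g n).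
Proof.
by apply/uclassP; apply: filterS2 (repr_uclass f) (repr_uclass g) => n /= -> ->.
Qed.

Lemma umulE f g : umul (uclass f) (uclass g) = uclass (fun n => f n * g n).
Proof.
by apply/uclassP; apply: filterS2 (repr_uclass f) (repr_uclass g) => n /= -> ->.
Qed.

Lemma uleP f g : reflect (U [set n | f n <= g n]) (ule (uclass f) (uclass g)).
Proof.
apply: (iffP (asboolP _));
  by apply: filterS3 (repr_uclass f) (repr_uclass g) => n /= -> ->.
Qed.

Lemma ultP f g : reflect (U [set n | f n < g n]) (ult (uclass f) (uclass g)).
Proof.
apply: (iffP (asboolP _));
  by apply: filterS3 (repr_uclass f) (repr_uclass g) => n /= -> ->.
Qed.

Lemma uaddA : associative uadd.
Proof.
elim/uclassW=> f; elim/uclassW=> g; elim/uclassW=> h; rewrite !uaddE.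
by congr uclass; apply/funext => n; rewrite addrA.
Qed.

Lemma uaddC : commutative uadd.
Proof.
elim/uclassW=> f; elim/uclassW=> g; rewrite !uaddE.
by congr uclass; apply/funext => n; rewrite addrC.
Qed.

Lemma uadd0 : left_id uzero uadd.
Proof.
by elim/uclassW=> f; rewrite uaddE; congr uclass; apply/funext => n; rewrite add0r.
Qed.

Lemma uaddN : left_inverse uzero uopp uadd.
Proof.
elim/uclassW=> f; rewrite uoppE uaddE.
by congr uclass; apply/funext => n; rewrite addNr.
Qed.

HB.instance Definition _ :=
  GRing.isZmodule.Build ultrapower uaddA uaddC uadd0 uaddN.

Lemma umulA : associative umul.
Proof.
elim/uclassW=> f; elim/uclassW=> g; elim/uclassW=> h; rewrite !umulE.
by congr uclass; apply/funext => n; rewrite mulrA.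
Qed.

Lemma umulC : commutative umul.
Proof.
elim/uclassW=> f; elim/uclassW=> g; rewrite !umulE.
by congr uclass; apply/funext => n; rewrite mulrC.
Qed.

Lemma umul1 : left_id uone umul.
Proof.
by elim/uclassW=> f; rewrite umulE; congr uclass; apply/funext => n; rewrite mul1r.
Qed.

Lemma umulD : left_distributive umul uadd.
Proof.
elim/uclassW=> f; elim/uclassW=> g; elim/uclassW=> h.
rewrite uaddE !umulE uaddE.
by congr uclass; apply/funext => n; rewrite mulrDl.
Qed.

Lemma uone_neq0 : uone != uzero.
Proof.
apply/eqP => /uclassP h; apply: (@filter_not_empty _ U).
by apply: filterS h => n /= /eqP; rewrite oner_eq0.
Qed.

HB.instance Definition _ := GRing.Zmodule_isComNzRing.Build ultrapower
  umulA umulC umul1 umulD uone_neq0.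

Lemma umulV (x : ultrapower) : x != 0 -> uinv x * x = 1.
Proof.
elim/uclassW: x => f f0; rewrite uinvE [LHS]umulE; apply/uclassP.
have [h|] := in_ultra_setVsetC [set n | f n = 0] UU.
  by case/eqP: f0; apply/uclassP.
by apply: filterS => n /= /eqP fn0; rewrite mulVf.
Qed.

Lemma uinv0 : uinv 0 = 0.
Proof. by rewrite [LHS]uinvE; congr uclass; apply/funext => n; rewrite invr0. Qed.

HB.instance Definition _ := GRing.ComNzRing_isField.Build ultrapower umulV uinv0.

Lemma ule0_add (x y : ultrapower) : ule 0 x -> ule 0 y -> ule 0 (x + y).
Proof.
elim/uclassW: x => f; elim/uclassW: y => g /uleP f0 /uleP g0.
rewrite [X in ule _ X]uaddE; apply/uleP.
by apply: filterS2 f0 g0 => n /=; exact: addr_ge0.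
Qed.

Lemma ule0_mul (x y : ultrapower) : ule 0 x -> ule 0 y -> ule 0 (x * y).
Proof.
elim/uclassW: x => f; elim/uclassW: y => g /uleP f0 /uleP g0.
rewrite [X in ule _ X]umulE; apply/uleP.
by apply: filterS2 f0 g0 => n /=; exact: mulr_ge0.
Qed.

Lemma ule0_anti (x : ultrapower) : ule 0 x -> ule x 0 -> x = 0.
Proof.
elim/uclassW: x => f /uleP f0 /uleP g0; apply/uclassP.
by apply: filterS2 f0 g0 => n /= h1 h2; apply/le_anti; rewrite h1 h2.
Qed.

Lemma usub_ge0 (x y : ultrapower) : ule 0 (y - x) = ule x y.
Proof.
elim/uclassW: x => f; elim/uclassW: y => g.
have -> : uclass g - uclass f = uclass (fun n => g n - f n).
  by rewrite [- _]uoppE [LHS]uaddE.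
by apply/uleP/uleP; apply: filterS => n /=; rewrite subr_ge0.
Qed.

Lemma ule0_total (x : ultrapower) : ule 0 x || ule x 0.
Proof.
elim/uclassW: x => f.
have [h|h] := in_ultra_setVsetC [set n | 0 <= f n] UU.
  by apply/orP; left; apply/uleP.
apply/orP; right; apply/uleP; apply: filterS h => n /= /negP.
by rewrite -ltNge => /ltW.
Qed.

Lemma unormN (x : ultrapower) : unorm (- x) = unorm x.
Proof.
elim/uclassW: x => f; rewrite [- _]uoppE !unormE.
by congr uclass; apply/funext => n; rewrite normrN.
Qed.

Lemma uge0_norm (x : ultrapower) : ule 0 x -> unorm x = x.
Proof.
elim/uclassW: x => f /uleP f0; rewrite unormE; apply/uclassP.
by apply: filterS f0 => n /= /ger0_norm.
Qed.

Lemma ult_def (x y : ultrapower) : ult x y = (y != x) && ule x y.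
Proof.
elim/uclassW: x => f; elim/uclassW: y => g; apply/ultP/andP.
- move=> fg; split; last by apply/uleP; apply: filterS fg => n /= /ltW.
  apply/eqP => /uclassP gf; apply: (@filter_not_empty _ U).
  by apply: filterS2 fg gf => n /= + gfn; rewrite gfn ltxx.
- move=> [/eqP gf /uleP fg].
  have [/uclassP//|h] := in_ultra_setVsetC [set n | g n = f n] UU.
  by apply: filterS2 fg h => n /= fgn /eqP gfn; rewrite lt_def gfn.
Qed.

HB.instance Definition _ := Num.IntegralDomain_isLeReal.Build ultrapower
  ule0_add ule0_mul ule0_anti usub_ge0 ule0_total unormN uge0_norm ult_def.

Lemma uclassD f g : uclass f + uclass g = uclass (fun n => f n + g n).
Proof. exact: uaddE. Qed.

Lemma uclassM f g : uclass f * uclass g = uclass (fun n => f n * g n).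
Proof. exact: umulE. Qed.

Lemma uclass_lt f g : (uclass f < uclass g) <-> U [set n | f n < g n].
Proof. by split=> [/ultP|h]; [|exact/ultP]. Qed.

Lemma uclass_norm f : `|uclass f| = uclass (fun n => `|f n|).
Proof. exact: unormE. Qed.

Definition uconst (r : K) : ultrapower := uclass (fun=> r).

End Ultrapower.

Definition star_finite (F : realFieldType) (x : F) : Prop :=
  exists n : nat, `|x| <= n%:R.

Definition infinitesimal (F : realFieldType) (x : F) : Prop :=
  forall n : nat, (0 < n)%N -> `|x| < n%:R^-1.

Definition free_filter (U : set_system nat) : Prop :=
  forall n : nat, U <> principal_filter n.

Definition card_lt (S T : Type) : Prop :=
  ([set: S] #<= [set: T])%card /\ ~ ([set: T] #<= [set: S])%card.

Section Completeness.
(* The topology that numFieldTopology puts on K (balls |x - y| < e) is the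
   order topology: itv_nbhsE. *)
Variable K : realFieldType.

Definition order_bounded (A : set K) : Prop := has_lbound A /\ has_ubound A.

Definition fip (T G : Type) (F : G -> set T) : Prop :=
  forall D : set G, finite_set D -> \bigcap_(i in D) F i !=set0.

(* Cardinals are represented by types. *)
Definition cantor_card_complete (kappa : Type) : Prop :=
  forall (G : Type) (a b : G -> K), card_lt G kappa ->
    (forall i, a i <= b i) ->
    fip (fun i => `[a i, b i]%classic) ->
    \bigcap_i `[a i, b i]%classic !=set0.

Definition leibniz_complete (U : set_system nat) (UU : UltraFilter U) : Prop :=
  forall x : ultrapower K UU, star_finite x ->
    exists! p : K * ultrapower K UU,
      infinitesimal p.2 /\ x = uconst UU p.1 + p.2.

Definition heine_borel_complete : Prop :=
  forall A : set K, compact A <-> closed A /\ order_bounded A.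

Definition monotone_complete : Prop :=
  forall u : nat -> K, order_bounded (range u) -> increasing_seq u ->
    exists l : K, u @ \oo --> l.

Definition cantor_complete : Prop :=
  forall a b : nat -> K, (forall n, a n <= b n) ->
    (forall n, `[a n.+1, b n.+1]%classic `<=` `[a n, b n]%classic) ->
    \bigcap_n `[a n, b n]%classic !=set0.

(* A cardinal kappa is aleph_1 when "less than kappa" means "countable". *)
Lemma cantor_complete_aleph1 (kappa : Type) :
  (forall G : Type, card_lt G kappa <-> countable [set: G]) ->
  cantor_card_complete kappa <-> cantor_complete.
Proof.
move=> aleph1; split=> [cc a b ab nested|cc G a b /aleph1 cG ab abF].
- have sub m n : (m <= n)%N -> `[a n, b n]%classic `<=` `[a m, b m]%classic.
    elim: n => [|n IH]; first by rewrite leqn0 => /eqP ->.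
    rewrite leq_eqVlt => /predU1P[->//|/IH h].
    by apply: subset_trans h; exact: nested.
  apply: cc => //; first by apply/aleph1; exact: countableP.
  move=> D /finite_fsetP[X ->].
  exists (a (\max_(i <- finmap.enum_fset X) i)%N) => i /= iX.
  apply: (sub _ (\max_(i <- finmap.enum_fset X) i)%N).
    exact: (@leq_bigmax_seq _ _ xpredT id).
  by rewrite /= in_itv /= lexx ab.
- have [[g0 _]|G0] := pselect (exists g : G, True); last first.
    by exists 0 => g; case: G0; exists g.
  have /countable_injP[f finj] := cG.
  pose e n := if pselect (exists g, f g = n) is left h then sval (cid h) else g0.
  have eK g : e (f g) = g.
    rewrite /e; case: pselect => [h|[]]; last by exists g.
    by case: cid => g' /= h'; apply: finj; rewrite ?inE.
  have abij i j : a i <= b j.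
    have [|x xij] := abF [set i; j]; first exact: finite_set2.
    have := xij i (or_introl erefl); have := xij j (or_intror erefl).
    by rewrite /= !in_itv /= => /andP[_ h1] /andP[h2 _]; exact: le_trans h1.
  pose A := fix A n := if n is m.+1 then Num.max (A m) (a (e n)) else a (e 0%N).
  pose B := fix B n := if n is m.+1 then Num.min (B m) (b (e n)) else b (e 0%N).
  have aA n : a (e n) <= A n by case: n => //= n; rewrite le_max lexx orbT.
  have bB n : B n <= b (e n) by case: n => //= n; rewrite ge_min lexx orbT.
  have Ab n i : A n <= b i by elim: n => [|n IH] /=; rewrite ?ge_max ?IH abij.
  have AB m n : A m <= B n by elim: n => [|n IH] /=; rewrite ?le_min ?IH Ab.
  have [||x xAB] := cc A B => // [n|].
    move=> x /=; rewrite !in_itv /= ge_max le_min -!andbA.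
    by move=> /and4P[-> _ -> _].
  exists x => g _ /=; have := xAB (f g) I; rewrite /= !in_itv /=.
  move=> /andP[h1 h2]; rewrite -(eK g).
  by rewrite (le_trans (aA _) h1) (le_trans h2 (bB _)).
Qed.

Definition weierstrass_complete : Prop :=
  forall u : nat -> K, order_bounded (range u) ->
    exists2 phi : nat -> nat, increasing_seq phi &
      exists l : K, u \o phi @ \oo --> l.

Definition bolzano_complete : Prop :=
  forall A : set K, order_bounded A -> infinite_set A ->
    exists x : K, limit_point A x.

(* S is an unbounded set of least cardinality, i.e. card S = cof K *)
Definition realizes_cof (S : set K) : Prop :=
  ~ order_bounded S /\
  forall T : set K, ~ order_bounded T -> (S #<= T)%card.

Definition directed (I : Type) (le : I -> I -> Prop) : Prop :=
  [/\ inhabited I,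
      forall i, le i i,
      forall i j k, le i j -> le j k -> le i k &
      forall i j, exists k, le i k /\ le j k].

Definition tails (I : Type) (le : I -> I -> Prop) : set_system I :=
  filter_from [set: I] (fun h => [set i | le h i]).

Definition fundamental (I : Type) (le : I -> I -> Prop) (f : I -> K) : Prop :=
  forall e : K, 0 < e ->
    exists h, forall i j, le h i -> le h j -> `|f i - f j| < e.

Definition cauchy_complete : Prop :=
  forall (I : Type) (le : I -> I -> Prop), directed le ->
    (exists2 S : set K, realizes_cof S & ([set: I] #= S)%card) ->
    forall f : I -> K, fundamental le f ->
      exists l : K, f @ tails le --> l.

Definition dedekind_complete : Prop :=
  forall A : set K, A !=set0 -> has_ubound A -> exists s : K, isLub A s.

Definition hilbert_complete : Prop :=
  ~ exists (L : realFieldType) (f : {rmorphism K -> L}),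
      [/\ Num.archimedean_axiom L,
          {mono f : x y / x <= y} &
          exists y : L, forall x : K, f x != y].

End Completeness.

(* Main.v *)
(* Every property is compared with Dedekind completeness.  Bisection encloses the
   least upper bound of A between a strictly increasing sequence of points that
   are not upper bounds and a nonincreasing sequence of upper bounds, and the
   Archimedean axiom makes the gap tend to 0; each sequential form of completeness
   yields a cluster point of the lower sequence, which is then the supremum.
   Conversely a supremum gives the limit of a bounded ultrafilter, hence the
   compactness of closed bounded sets.  For Hilbert completeness, an Archimedean
   field embeds into the real numbers by matching the rational cuts, and the
   embedding has to be surjective. *)
From HB Require Import structures.
Require Import Defs.
From mathcomp Require Import all_boot all_order all_algebra.
From mathcomp Require Import all_classical all_reals all_analysis.
From mathcomp Require Import Rstruct lra ring.

Set Implicit Arguments.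
Unset Strict Implicit.
Unset Printing Implicit Defensive.

Import Order.TTheory GRing.Theory Num.Theory.
Import numFieldTopology.Exports.

Local Open Scope classical_set_scope.
Local Open Scope ring_scope.

(** * Cluster points of sequences *)

Lemma cluster_seqP (K : realFieldType) (u : nat -> K) (l : K) :
  cluster (u @ \oo) l <->
  forall e N, 0 < e -> exists2 n, (N <= n)%N & `|l - u n| < e.
Proof.
split=> [ul e N e0|ul A B [N _ NA] /nbhs_ballP[e /= e0 eB]].
- have [||y [[n Nn <-] yb]] :=
      ul [set u n | n in [set n | (N <= n)%N]] (ball l e).
  + by exists N => // n Nn; exists n.
  + exact: nbhsx_ballx.
  + by exists n.
- by have [n Nn lun] := ul e N e0; exists (u n); split; [exact: NA|exact: eB].
Qed.

(** * Bisection towards a least upper bound in an Archimedean field *)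

Section Archimedean.
Variables (K : realFieldType) (archiK : Num.archimedean_axiom K).

Lemma archi_inv (e : K) : 0 < e -> exists n : nat, n.+1%:R^-1 < e.
Proof.
move=> e0; have [n ne] := archiK e^-1; exists n.
rewrite invf_plt ?posrE ?ltr0Sn// (le_lt_trans (ler_norm _))//.
by rewrite (lt_le_trans ne)// ler_nat.
Qed.

Lemma archi_rat_dense (x y : K) : x < y -> exists q : rat, x < ratr q < y.
Proof.
(* The Archimedean axiom equips [K] itself with the structure over which [rat_in_itvoo] is
   stated. *)
pose A : archiRealFieldType :=
  HB.pack (Num.RealField.sort K) (Num.RealField.class K)
    (Num.NumDomain_bounded_isArchimedean.Build K archiK).
by move=> /(@rat_in_itvoo A)[q]; rewrite in_itv /=; exists q.
Qed.

(* Subtracting [n.+1%:R^-1] from the lower ends of the bisection intervals makes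
   them strictly increasing. *)
Lemma ubound_bisection (A : set K) : A !=set0 -> has_ubound A ->
  exists a b : nat -> K,
    [/\ increasing_seq a, nonincreasing_seq b,
        forall n, ~ ubound A (a n), forall n, ubound A (b n) &
        forall e, 0 < e -> exists N, forall n, (N <= n)%N -> b n - a n < e].
Proof.
move=> [x0 Ax0] [y0 y0A].
pose step (p : K * K) := let m := (p.1 + p.2) / 2 in
  if `[< ubound A m >] then (p.1, m) else (m, p.2).
(* [x0 - 1] is below the element [x0] of [A], so the left end starts as a non-upper bound. *)
pose s n := iter n step (x0 - 1, y0).
have inv n : [/\ ~ ubound A (s n).1, ubound A (s n).2 &
   (s n).2 - (s n).1 = (y0 - x0 + 1) / (2 ^ n)%:R].
  elim: n => [|n [IH1 IH2 IH3]].
    split=> //=; last by rewrite expn0 divr1; ring.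
    by move=> /(_ _ Ax0); lra.
  rewrite /s iterS -/(s n) /step; set m := _ / _.
  have e n' : (2 ^ n'.+1)%:R = 2 * (2 ^ n')%:R :> K by rewrite expnS natrM.
  have p : 0 < (2 ^ n)%:R :> K by rewrite ltr0n expn_gt0.
  have E : (y0 - x0 + 1) / (2 ^ n.+1)%:R = ((s n).2 - (s n).1) / 2.
    by rewrite IH3 e; field; rewrite gt_eqF.
  by case: asboolP => mA /=; split=> //; rewrite E /m; lra.
have c0 : 0 < y0 - x0 + 1 by have := y0A _ Ax0; lra.
have lt n : (s n).1 < (s n).2.
  have [_ _ h] := inv n; rewrite -subr_gt0 h divr_gt0// ltr0n expn_gt0//.
exists (fun n => (s n).1 - n.+1%:R^-1), (fun n => (s n).2).
split.
- apply/increasing_seqP => n; apply: ler_ltD.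
    rewrite /s iterS -/(s n) /step; case: asboolP => //= _; have := lt n; lra.
  by rewrite ltrN2 ltf_pV2 ?posrE ?ltr0Sn// ltr_nat.
- apply/nonincreasing_seqP => n.
  by rewrite {1}/s iterS -/(s n) /step; case: asboolP => //= _; have := lt n; lra.
- move=> n hn; have [h _ _] := inv n; apply: h => x /hn /= xs.
  apply: (le_trans xs).
  by rewrite gerBl invr_ge0 ler0n.
- by move=> n; have [] := inv n.
(* The gap is [(y0 - x0 + 1) / 2 ^ n + 1 / (n + 1)], at most [(y0 - x0 + 2) / (n + 1)] because
   [n + 1 <= 2 ^ n]; hence the constant. *)
- move=> e e0; have [|N hN] := @archi_inv (e / (y0 - x0 + 2)).
    by apply: divr_gt0 => //; lra.
  exists N => n Nn /=; have [_ _ h] := inv n.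
  have -> : (s n).2 - ((s n).1 - n.+1%:R^-1) =
      ((s n).2 - (s n).1) + n.+1%:R^-1 by ring.
  have hN' : n.+1%:R^-1 < e / (y0 - x0 + 2).
    by apply: le_lt_trans hN; rewrite lef_pV2 ?posrE ?ltr0Sn// ler_nat.
  apply: (@le_lt_trans _ _ ((y0 - x0 + 2) / n.+1%:R)).
    rewrite h; have -> : y0 - x0 + 2 = (y0 - x0 + 1) + 1 by ring.
    rewrite [leRHS]mulrDl mul1r lerD2r ler_wpM2l ?(ltW c0)//.
    by rewrite lef_pV2 ?posrE ?ltr0n ?expn_gt0// ler_nat ltn_expl.
  by rewrite mulrC -ltr_pdivlMr//; lra.
Qed.

(** The cluster point [l] is the supremum: a point of [A] above [l] would exceed some upper bound
    [b n], and an upper bound below [l] would lie below some [a n]. *)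
Lemma dedekind_cluster :
  (forall a b : nat -> K, increasing_seq a -> nonincreasing_seq b ->
     (forall m n, a m <= b n) ->
     (forall e, 0 < e -> exists N, forall n, (N <= n)%N -> b n - a n < e) ->
     exists l, cluster (a @ \oo) l) ->
  dedekind_complete K.
Proof.
move=> H A A0 Aub.
have [a [b [ainc bdec aA bA ab]]] := ubound_bisection A0 Aub.
have lt_ub n z : ubound A z -> a n < z.
  move=> zA; rewrite ltNge; apply/negP => za; apply: (aA n) => x /zA xz.
  exact: le_trans za.
have [|l al] := H a b ainc bdec _ ab; first by move=> m n; apply/ltW/lt_ub.
move/cluster_seqP: al => near.
exists l; split=> [x Ax|z zA]; rewrite leNgt; apply/negP => lx.
- have e0 : 0 < (x - l) / 2 by lra.
  have [N hN] := ab _ e0; have [n Nn] := near _ N e0.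
  by rewrite ltr_norml => /andP[? ?]; have := hN _ Nn; have := bA n _ Ax; lra.
- have [|n _] := near (l - z) 0%N; first by lra.
  by rewrite ltr_norml => /andP[? ?]; have := lt_ub n _ zA; lra.
Qed.

End Archimedean.

(** Cantor's diagonal argument. With [set nat] as the cardinal, sequences of intervals become
    admissible families in Cantor completeness. *)
Lemma card_lt_powerset (T : pointedType) : card_lt T (set T).
Proof.
split.
  have sing_inj : {in [set: T] &, injective (@set1 T)}.
    move=> x y _ _ xy.
    have : [set x] x by [].
    by rewrite xy.
  rewrite -(card_le_eql (inj_card_eq sing_inj)); exact: subset_card_le.
move=> /pcard_leP[f].
pose D := [set x | exists2 A, f A = x & ~ A x].
have nD : ~ D (f D).
  by move=> DfD; have [A fA nA] := DfD; apply: nA; rewrite (inj _ _ fA) ?inE.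
by apply: (nD); exists D.
Qed.

(** * From the topological and order forms of completeness to Dedekind completeness *)

Section ToDedekind.
Variables (K : realFieldType) (archiK : Num.archimedean_axiom K).

Lemma enclosed_cluster (a b : nat -> K) (l : K) :
  (forall e, 0 < e -> exists N, forall n, (N <= n)%N -> b n - a n < e) ->
  (forall n, a n <= l <= b n) -> cluster (a @ \oo) l.
Proof.
move=> ab al; apply/cluster_seqP => e N e0; have [M hM] := ab e e0.
exists (maxn N M); first exact: leq_maxl.
have /andP[al1 al2] := al (maxn N M); have := hM _ (leq_maxr N M).
by rewrite ger0_norm ?subr_ge0//; apply: le_lt_trans; rewrite lerD2r.
Qed.

Lemma cantor_card_dedekind :
  (forall kappa : Type, infinite_set [set: kappa] ->
     cantor_card_complete K kappa) -> dedekind_complete K.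
Proof.
move=> cc; apply: dedekind_cluster => // a b ainc bdec ab dab.
have [||n|D /finite_fsetP[X ->]|l lab] := cc (set nat) _ nat a b.
- by apply/infiniteP; have [] := card_lt_powerset nat.
- exact: card_lt_powerset.
- exact: ab.
(* The intervals are nested, so the left end of greatest index lies in all of the finitely many. *)
- exists (a (\max_(i <- finmap.enum_fset X) i)%N) => i /= iX.
  rewrite in_itv /= ab andbT ainc.
  exact: (@leq_bigmax_seq _ _ xpredT id).
- exists l; apply: (enclosed_cluster dab) => n.
  by have := lab n I; rewrite /= in_itv.
Qed.

Lemma cantor_dedekind : cantor_complete K -> dedekind_complete K.
Proof.
move=> cc; apply: dedekind_cluster => // a b ainc bdec ab dab.
have [n|n x /=|l lab] := cc a b; first exact: ab.
- rewrite !in_itv /= => /andP[h1 h2]; rewrite (le_trans _ h1) ?ainc //.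
  by rewrite (le_trans h2)//; apply: bdec.
- exists l; apply: (enclosed_cluster dab) => n.
  by have := lab n I; rewrite /= in_itv.
Qed.

(** Compactness is phrased with proper filters, so it applies directly to the tails of [a], which
    stay in the closed bounded interval from [a 0] to [b 0]. *)
Lemma heine_borel_dedekind : heine_borel_complete K -> dedekind_complete K.
Proof.
move=> hb; apply: dedekind_cluster => // a b ainc bdec ab dab.
have [_ /(_ _)cpt] := hb `[a 0%N, b 0%N]%classic.
have /cpt/(_ (a @ \oo)) : closed `[a 0%N, b 0%N]%classic /\
    order_bounded `[a 0%N, b 0%N]%classic.
  split; first exact: interval_closed.
  by split; [exists (a 0%N)|exists (b 0%N)] => x /=; rewrite in_itv /= => /andP[].
case=> [|l [_ al]]; last by exists l.
by exists 0%N => // n _ /=; rewrite in_itv /= ab ainc andbT.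
Qed.

Lemma cvg_seq_cluster (u : nat -> K) (l : K) : u @ \oo --> l ->
  cluster (u @ \oo) l.
Proof.
move=> ul A B uA /ul uB; apply: (@filter_ex _ (u @ \oo)); exact: filterI.
Qed.

Lemma monotone_dedekind : monotone_complete K -> dedekind_complete K.
Proof.
move=> mc; apply: dedekind_cluster => // a b ainc bdec ab dab.
have [|l al] := mc a _ ainc; last by exists l; exact: cvg_seq_cluster.
split; [exists (a 0%N)|exists (b 0%N)] => _ [n _ <-]; last exact: ab.
by rewrite ainc.
Qed.

(** A strictly increasing [phi] satisfies [n <= phi n], so late terms of the subsequence are late
    terms of [u]. *)
Lemma subseq_cluster (u : nat -> K) (phi : nat -> nat) (l : K) :
  increasing_seq phi -> cluster (u \o phi @ \oo) l -> cluster (u @ \oo) l.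
Proof.
move=> phi_inc /cluster_seqP ul; apply/cluster_seqP => e N e0.
have [n Nn lun] := ul e N e0; exists (phi n) => //; apply: leq_trans Nn _.
have {}phi_inc := (increasing_seqP _).2 phi_inc.
by elim: n {lun} => // n /leq_ltn_trans; apply; exact: phi_inc.
Qed.

Lemma weierstrass_dedekind : weierstrass_complete K -> dedekind_complete K.
Proof.
move=> wc; apply: dedekind_cluster => // a b ainc bdec ab dab.
have [|phi phi_inc [l al]] := wc a.
  split; [exists (a 0%N)|exists (b 0%N)] => _ [n _ <-]; last exact: ab.
  by rewrite ainc.
by exists l; apply: (subseq_cluster phi_inc); exact: cvg_seq_cluster.
Qed.

(** Finitely many points distinct from [l] keep a positive distance from it. *)
Lemma limit_point_infinite (A : set K) (l : K) (V : set K) :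
  limit_point A l -> nbhs l V -> infinite_set (V `&` A).
Proof.
pose KA : archiRealFieldType :=
  HB.pack (Num.RealField.sort K) (Num.RealField.class K)
    (Num.NumDomain_bounded_isArchimedean.Build K archiK).
by move=> /(@limit_point_infinite_setP KA)/(_ V).
Qed.

Lemma bolzano_dedekind : bolzano_complete K -> dedekind_complete K.
Proof.
move=> bc; apply: dedekind_cluster => // a b ainc bdec ab dab.
have [||l al] := bc (range a).
- split; [exists (a 0%N)|exists (b 0%N)] => _ [n _ <-]; last exact: ab.
  by rewrite ainc.
- apply/infiniteP; have a_inj : {in [set: nat] &, injective a}.
    by move=> m n _ _; exact: (inc_inj ainc).
  by rewrite (card_le_eqr (inj_card_eq a_inj)).
exists l; apply/cluster_seqP => e N e0.
(* If no term of index at least [N] were in the ball, it would meet the range in at most [N]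
   points. *)
apply: contrapT => far; apply: (limit_point_infinite al (nbhsx_ballx l e e0)).
apply: (@sub_finite_set _ _ (a @` `I_N)); last exact/finite_image/finite_II.
move=> x [/= lan [n _ an]]; exists n => //=; rewrite ltnNge; apply/negP => Nn.
by apply: far; exists n => //; rewrite an.
Qed.

(** An Archimedean field has countable cofinality, since finite sets are bounded. This admits
    sequences among the nets of Cauchy completeness. *)
Lemma realizes_cof_nat : realizes_cof (range (fun n => n%:R : K)).
Proof.
split=> [|T Tunb].
  move=> [_ [x xub]].
  have [n xn] := archiK x; have /xub : range (fun n => n%:R : K) n%:R by exists n.
  by rewrite leNgt (le_lt_trans (ler_norm x) xn).
have n_inj : {in [set: nat] &, injective (fun n => n%:R : K)}.
  by move=> m n _ _ /eqP; rewrite eqr_nat => /eqP.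
rewrite (card_le_eql (inj_card_eq n_inj)); apply/infiniteP => /finite_fsetP[X TX].
apply: Tunb; rewrite TX; split.
(* Starting the folds at [0] can only loosen the bounds. *)
- exists (\big[Num.min/0]_(i <- finmap.enum_fset X) i) => x /= xX.
  exact: ge_bigmin_seq.
- exists (\big[Num.max/0]_(i <- finmap.enum_fset X) i) => x /= xX.
  exact: le_bigmax_seq.
Qed.

Lemma cauchy_dedekind : cauchy_complete K -> dedekind_complete K.
Proof.
move=> cc; apply: dedekind_cluster => // a b ainc bdec ab dab.
have [|||l al] := cc nat (fun m n => (m <= n)%N) _ _ a.
- split=> [|//|i j k|i j]; [exact: inhabits 0%N|exact: leq_trans|].
  by exists (maxn i j); rewrite leq_maxl leq_maxr.
- exists (range (fun n => n%:R : K)); first exact: realizes_cof_nat.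
  rewrite card_eq_sym; apply: inj_card_eq => m n _ _ /eqP.
  by rewrite eqr_nat => /eqP.
(* From index [N] on, all terms lie between [a N] and [b N]. *)
- move=> e e0; have [N hN] := dab e e0; exists N => i j Ni Nj.
  have := hN N (leqnn N); apply: le_lt_trans.
  have : a N <= a i by rewrite ainc.
  have : a N <= a j by rewrite ainc.
  by have := ab i N; have := ab j N; rewrite ler_norml; lra.
- exists l; apply/cluster_seqP => e N e0.
  have [M _ hM] := al _ (nbhsx_ballx l e e0).
  exists (maxn N M); first exact: leq_maxl.
  exact/hM/leq_maxr.
Qed.

End ToDedekind.

(** * Finite and infinitesimal classes in the ultrapower *)

Section Ultrapower.
Variables (K : realFieldType) (archiK : Num.archimedean_axiom K).
Variables (U : set_system nat) (UU : UltraFilter U).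

(** An ultrafilter containing a singleton is principal, so a free one contains the complement of
    each singleton; the tails arise by removing points one at a time. *)
Lemma free_ultra_tail (N : nat) : free_filter U -> U [set n | (N <= n)%N].
Proof.
move=> freeU; elim: N => [|N IH]; first by apply: filterS filterT.
have [UN|UN] := in_ultra_setVsetC [set N] UU.
  exfalso; apply: (freeU N); apply/seteqP; split=> A UA.
    by apply/principal_filterP; have [_ [-> ]] := filter_ex (filterI UN UA).
  by apply: filterS UN => _ ->; exact/principal_filterP.
apply: filterS2 IH UN => n /= Nn nN.
by rewrite ltn_neqAle Nn andbT eq_sym; apply/eqP.
Qed.

Lemma uconst_natr (n : nat) : n%:R = uconst UU (n%:R : K).
Proof. by elim: n => // n IH; rewrite !mulrS IH [LHS]uclassD. Qed.

Lemma star_finite_uclass (f : nat -> K) :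
  star_finite (uclass UU f) <-> exists n : nat, U [set k | `|f k| <= n%:R].
Proof.
by split=> -[n fn]; exists n; move: fn;
  rewrite uclass_norm uconst_natr => /uleP.
Qed.

(** By the Archimedean axiom, testing against all [1/n] is the same as testing against all positive
    elements of [K]. *)
Lemma infinitesimal_uclass (f : nat -> K) :
  infinitesimal (uclass UU f) <-> forall e, 0 < e -> U [set k | `|f k| < e].
Proof.
have E n : n%:R^-1 = uconst UU (n%:R^-1 : K) by rewrite uconst_natr [LHS]uinvE.
split=> [fi e e0|fi n n0]; last first.
  by rewrite uclass_norm E uclass_lt; apply: fi; rewrite invr_gt0 ltr0n.
have [n ne] := archi_inv archiK e0; have := fi n.+1 isT.
rewrite uclass_norm E uclass_lt; apply: filterS => k /= h; exact: lt_trans ne.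
Qed.

(** The standard part [r] of the class of [u] is a cluster point: [u] is near [r] on a set of [U],
    and freeness makes that set meet every tail. *)
Lemma leibniz_cluster (u : nat -> K) : free_filter U ->
  leibniz_complete K UU -> (exists n : nat, forall k, `|u k| <= n%:R) ->
  exists l, cluster (u @ \oo) l.
Proof.
move=> freeU lc [n un].
have [|[r d] [/= [di ud] _]] := lc (uclass UU u).
  by apply/star_finite_uclass; exists n; apply: filterS filterT => k _; exact: un.
exists r; apply/cluster_seqP => e N e0.
elim/uclassW: d di ud => d /infinitesimal_uclass/(_ e e0) de.
rewrite [X in _ = X]uclassD => /uclassP ud.
have [k [[/= kN dk] uk]] :=
  filter_ex (filterI (filterI (free_ultra_tail N freeU) de) ud).
by exists k => //; rewrite uk opprD addNKr normrN.
Qed.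

Lemma leibniz_dedekind : free_filter U ->
  leibniz_complete K UU -> dedekind_complete K.
Proof.
move=> freeU lc; apply: dedekind_cluster => // a b ainc bdec ab dab.
apply: leibniz_cluster => //; have [n an] := archiK (`|a 0%N| + `|b 0%N|).
exists n => k; have a0k : a 0%N <= a k by rewrite ainc.
have := ab k 0%N; have := ler_norm (b 0%N); have := ler_norm (- a 0%N).
have := normr_ge0 (b 0%N); have := normr_ge0 (a 0%N); move: an.
rewrite normrN ger0_norm ?addr_ge0// => an ? ? ? ? ?.
by rewrite ler_norml; apply/andP; split; lra.
Qed.

End Ultrapower.

(** * Ultrafilter limits and compactness from suprema *)

Section FromDedekind.
Variables (K : realFieldType) (dedK : dedekind_complete K).

(** The limit is the supremum of the [r] with [r <= f] on a set of [U]. As an ultrafilter decides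
    [s + e / 2 <= f], which cannot hold on a set of [U], the opposite inequality does. *)
Lemma dedekind_ultra_cvg (T : Type) (U : set_system T) (UU : UltraFilter U)
    (f : T -> K) (c d : K) :
  U [set t | c <= f t <= d] -> exists s : K, f @ U --> s.
Proof.
move=> Ucd; have [||s [sub lub]] := dedK (A := [set r | U [set t | r <= f t]]).
- by exists c; apply: filterS Ucd => t /= /andP[].
- exists d => r /= Ur; have [t [/= rt /andP[_ td]]] := filter_ex (filterI Ur Ucd).
  exact: le_trans td.
exists s => B /nbhs_ballP[e /= e0 eB]; change (U (f @^-1` B)).
have [Us|Us] := in_ultra_setVsetC [set t | s + e / 2 <= f t] UU.
  have := sub _ Us; lra.
have [r Ur sr] : exists2 r, U [set t | r <= f t] & s - e < r.
  apply: contrapT => h; suff : s <= s - e by lra.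
  apply: lub => r Ur.
  by rewrite leNgt; apply/negP => sr; apply: h; exists r.
apply: filterS2 Us Ur => t /= ft rf; apply: eB.
have fs : f t < s + e / 2 by rewrite ltNge; apply/negP.
by rewrite /ball /= ltr_norml; apply/andP; split; lra.
Qed.

Lemma dedekind_compact (A : set K) : closed A -> order_bounded A -> compact A.
Proof.
move=> Acl [[c cA] [d dA]]; rewrite compact_ultra => F FU FA.
have [|s Fs] := @dedekind_ultra_cvg _ F FU id c d.
  by apply: filterS FA => x Ax /=; rewrite cA ?dA.
exists s; split=> //; apply: Acl => B /Fs FB.
exact: filter_ex (filterI FA FB).
Qed.

(** Serves both sequences and nets: the image filter contains a compact interval. *)
Lemma dedekind_cluster_cvg (T : Type) (F : set_system T) (FF : ProperFilter F)
    (f : T -> K) (c d : K) :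
  F [set t | c <= f t <= d] -> exists s : K, cluster (f @ F) s.
Proof.
move=> Fcd; have : compact `[c, d]%classic.
  apply: dedekind_compact; first exact: interval_closed.
  by split; [exists c|exists d] => x /=; rewrite in_itv /= => /andP[].
case/(_ (f @ F)) => [|s [_ ?]]; last by exists s.
change (F (f @^-1` `[c, d])); by apply: filterS Fcd => t /=; rewrite in_itv.
Qed.

End FromDedekind.

(** * From Dedekind completeness to the other forms *)

Section FromDedekindArchimedean.
Variables (K : realFieldType) (archiK : Num.archimedean_axiom K).

(** The open intervals from [-n] to [n] cover [K] by the Archimedean axiom, and the greatest index
    of a finite subcover gives the bounds. *)
Lemma compact_order_bounded (A : set K) : compact A -> order_bounded A.
Proof.
rewrite compact_cover => Aco.
have [|p Ap|D _ DA] :=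
    Aco nat [set: nat] (fun n => `](- n%:R : K), n%:R[%classic).
- by move=> n _; exact: interval_open.
- have [n pn] := archiK p; exists n => //.
  by rewrite /= in_itv /= -ltr_norml.
have bound p : A p -> `|p| <= (\max_(i <- finmap.enum_fset D) i)%N%:R.
  move=> /DA[n /= nD]; rewrite in_itv /= -ltr_norml => /ltW/le_trans; apply.
  by rewrite ler_nat; exact: (@leq_bigmax_seq _ _ xpredT id).
split; [exists (- (\max_(i <- finmap.enum_fset D) i)%N%:R)|
        exists (\max_(i <- finmap.enum_fset D) i)%N%:R] => p /bound;
  by rewrite ler_norml => /andP[].
Qed.

Hypothesis dedK : dedekind_complete K.

Lemma dedekind_heine_borel : heine_borel_complete K.
Proof.
move=> A; split=> [Aco|[Acl Abd]]; last exact: dedekind_compact.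
split; last exact: compact_order_bounded.
by apply: compact_closed Aco; exact: Rhausdorff.
Qed.

(** The supremum of the left ends lies in every interval, each right end being an upper bound. For
    empty [G] the intersection is all of [K]. *)
Lemma dedekind_intervals (G : Type) (a b : G -> K) :
  (forall i j, a i <= b j) -> \bigcap_i `[a i, b i]%classic !=set0.
Proof.
move=> ab; have [[g _]|G0] := pselect (exists g : G, True); last first.
  by exists 0 => g; case: G0; exists g.
have [||s [sub lub]] := dedK (A := range a).
- by exists (a g), g.
- by exists (b g) => _ [i _ <-].
exists s => i _ /=; rewrite in_itv /=; apply/andP; split.
  by apply: sub; exists i.
by apply: lub => _ [j _ <-].
Qed.

Lemma dedekind_cantor_card (kappa : Type) : cantor_card_complete K kappa.
Proof.
move=> G a b _ ab abF; apply: dedekind_intervals => i j.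
have [|x xij] := abF [set i; j]; first exact: finite_set2.
have := xij i (or_introl erefl); have := xij j (or_intror erefl).
by rewrite /= !in_itv /= => /andP[_ h1] /andP[h2 _]; exact: le_trans h1.
Qed.

Lemma dedekind_cantor : cantor_complete K.
Proof.
move=> a b ab nest; apply: dedekind_intervals => i j.
have sub m n : (m <= n)%N -> `[a n, b n]%classic `<=` `[a m, b m]%classic.
  elim: n => [|n IH]; first by rewrite leqn0 => /eqP ->.
  rewrite leq_eqVlt => /predU1P[->//|/IH h].
  by apply: subset_trans h; exact: nest.
have aN : `[a (maxn i j), b (maxn i j)]%classic (a (maxn i j)).
  by rewrite /= in_itv /= lexx ab.
have := sub i _ (leq_maxl i j) _ aN; have := sub j _ (leq_maxr i j) _ aN.
by rewrite /= !in_itv /= => /andP[_ h1] /andP[h2 _]; exact: le_trans h1.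
Qed.

Lemma bounded_seq_cluster (u : nat -> K) :
  order_bounded (range u) -> exists l, cluster (u @ \oo) l.
Proof.
move=> [[c cu] [d ud]]; apply: (@dedekind_cluster_cvg _ dedK _ _ _ _ c d).
by apply: filterS filterT => n _ /=; rewrite cu ?ud//; exists n.
Qed.

Lemma dedekind_monotone : monotone_complete K.
Proof.
move=> u [_ ubd] uinc; have [||l [ul lub]] := dedK (A := range u) => //.
  by exists (u 0%N), 0%N.
exists l => B /nbhs_ballP[e /= e0 eB].
have [N lN] : exists N, l - e < u N.
  apply: contrapT => h; suff : l <= l - e by lra.
  by apply: lub => _ [n _ <-]; rewrite leNgt; apply/negP => un;
    apply: h; exists n.
exists N => // n /= Nn; apply: eB.
have : u N <= u n by rewrite uinc.
have := ul (u n) (ex_intro2 _ _ n I erefl).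
by rewrite /ball /= ltr_norml; lra.
Qed.

Lemma cluster_subseq (u : nat -> K) (l : K) : cluster (u @ \oo) l ->
  exists2 phi : nat -> nat, increasing_seq phi & u \o phi @ \oo --> l.
Proof.
move=> /cluster_seqP ul.
have /choice[g gP] (p : nat * nat) :
    exists n, (p.1 <= n)%N /\ `|l - u n| < p.2.+1%:R^-1.
  have [|n pn lun] := ul p.2.+1%:R^-1 p.1; last by exists n.
  by rewrite invr_gt0 ltr0n.
(* [g (N, k)] is an index at least [N] whose term is within [1/(k+1)] of [l]; asking for at least
   [(phi m).+1] forces strict growth. *)
pose phi := fix phi n := if n is m.+1 then g ((phi m).+1, n) else g (0, 0)%N.
exists phi; first by apply/increasing_seqP => n; have [] := gP ((phi n).+1, n.+1).
move=> B /nbhs_ballP[e /= e0 eB]; have [N Ne] := archi_inv archiK e0.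
exists N => // n /= Nn; apply: eB; apply: lt_trans Ne.
apply: (@lt_le_trans _ _ n.+1%:R^-1); last first.
  by rewrite lef_pV2 ?posrE ?ltr0n// ler_nat.
by case: n Nn => [|n] _; [have [] := gP (0, 0)%N|have [] := gP ((phi n).+1, n.+1)].
Qed.

Lemma dedekind_weierstrass : weierstrass_complete K.
Proof.
move=> u /bounded_seq_cluster[l /cluster_subseq[phi phi_inc ul]].
by exists phi => //; exists l.
Qed.

Lemma dedekind_bolzano : bolzano_complete K.
Proof.
move=> A [[c cA] [d dA]] /infiniteP/pcard_leP[u].
have uA n : A (u n) by exact: funS.
have [|l ul] := bounded_seq_cluster (u := u).
  by split; [exists c|exists d] => _ [n _ <-]; [exact: cA|exact: dA].
exists l => B lB.
(* By injectivity at most one term equals [l]; a limit point requires terms different from it. *)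
have [N uN] : exists N, forall n, (N <= n)%N -> u n != l.
  have [[m um]|h] := pselect (exists m, u m = l); last first.
    by exists 0%N => n _; apply/eqP => un; apply: h; exists n.
  exists m.+1 => n mn; apply/eqP; rewrite -um => /inj.
  by rewrite !inE => /(_ I I) nm; rewrite nm ltnn in mn.
have [||_ [[n Nn <-] Bn]] := ul [set u n | n in [set n | (N <= n)%N]] B => //.
  by exists N => // n Nn; exists n.
by exists (u n); split=> //; exact: uN.
Qed.

(** A fundamental net is eventually within [1] of one of its values, so its tails have a cluster
    point, and a fundamental net converges to any cluster point. *)
Lemma dedekind_cauchy : cauchy_complete K.
Proof.
move=> I le [[i0] lexx_ letr ledir] _ f fund.
have tails_proper : ProperFilter (tails le).
  apply: filter_from_proper; last by move=> h _; exists h; exact: lexx_.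
  apply: filter_from_filter; first by exists i0.
  move=> i j _ _; have [k [ik jk]] := ledir i j; exists k => // m km.
  by split; [exact: letr km|exact: letr km].
have [h hP] := fund 1 ltr01.
have [|l fl] := @dedekind_cluster_cvg _ dedK _ _ tails_proper
    f (f h - 1) (f h + 1).
  exists h => // i hi /=; have := hP _ _ hi (lexx_ h).
  by rewrite ltr_norml => /andP[? ?]; apply/andP; split; lra.
exists l => B /nbhs_ballP[e /= e0 eB].
have [|k kP] := fund (e / 2); first lra.
have [||_ [[j kj <-] fjl]] := fl [set f i | i in [set i | le k i]] (ball l (e / 2)).
- by exists k => // i ki; exists i.
- by apply: nbhsx_ballx; lra.
exists k => // i /= ki; apply: eB; move: fjl (kP _ _ ki kj).
by rewrite /ball /= !ltr_norml => /andP[? ?] /andP[? ?]; apply/andP; split; lra.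
Qed.

(** The standard part is the limit of a representative along [U]. *)
Lemma dedekind_leibniz (U : set_system nat) (UU : UltraFilter U) :
  leibniz_complete K UU.
Proof.
elim/uclassW => f /star_finite_uclass[n fn].
have [|s fs] := @dedekind_ultra_cvg _ dedK _ _ UU f (- n%:R) n%:R.
  by apply: filterS fn => k /=; rewrite ler_norml.
have Us e : 0 < e -> U [set k | `|s - f k| < e].
  by move=> e0; exact: fs (nbhsx_ballx s e e0).
exists (s, uclass UU (fun k => f k - s)); split=> /=.
  split; last by rewrite [RHS]uclassD; congr uclass; apply/funext => k; ring.
  apply/infinitesimal_uclass => // e e0.
  by apply: filterS (Us e e0) => k /=; rewrite distrC.
move=> [r d] /= [di fr]; elim/uclassW: d di fr => d.
move=> /(infinitesimal_uclass archiK) di; rewrite [RHS]uclassD => /uclassP fr.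
have sr : s = r.
  (* At a common index both errors are below half the distance from [s] to [r], against the triangle
     inequality. *)
  apply: contrapT => /eqP sr; have e0 : 0 < `|s - r| / 2.
    by rewrite divr_gt0// normr_gt0 subr_eq0.
  have [k [[/= fk dk] sk]] := filter_ex
    (filterI (filterI fr (di _ e0)) (Us _ e0)).
  have : `|s - r| <= `|s - f k| + `|d k|.
    rewrite (le_trans _ (ler_normD _ _))// fk le_eqVlt; apply/orP; left.
    by apply/eqP; congr `|_|; ring.
  by move: sk dk; rewrite /=; lra.
congr pair => //; apply/uclassP; apply: filterS fr => k /= ->.
by rewrite sr addrAC subrr add0r.
Qed.

(** Let [s] be the supremum of the elements sent below the missed [y]. A gap between [f s] and [y]
    exceeds some [1/(m+1)], which comes from [K], so shifting [s] by it contradicts the choice of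
    [s]. *)
Lemma dedekind_hilbert : hilbert_complete K.
Proof.
move=> [L [f [archL fmono [y fy]]]].
have fn n : f n.+1%:R^-1 = n.+1%:R^-1 by rewrite fmorphV rmorph_nat.
have [n yn] := archL y; move: yn; rewrite ltr_norml => /andP[ny yn].
have [||s [sub lub]] := dedK (A := [set x | f x <= y]).
- by exists (- n%:R); rewrite /= rmorphN rmorph_nat ltW.
- exists n%:R => x /= xy; rewrite -fmono rmorph_nat.
  exact: le_trans xy (ltW yn).
have [fsy|yfs|/eqP] := ltgtP (f s) y; last exact/negP.
- have [|m sm] := archi_inv archL (e := y - f s); first by rewrite subr_gt0.
  have : s + m.+1%:R^-1 <= s by apply: sub; rewrite /= rmorphD fn -lerBrDl ltW.
  by rewrite gerDl leNgt invr_gt0 ltr0n.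
- have [|m sm] := archi_inv archL (e := f s - y); first by rewrite subr_gt0.
  have : s <= s - m.+1%:R^-1.
    by apply: lub => x /= xy; rewrite -fmono rmorphB fn (le_trans xy)//
      lerBrDl -lerBrDr ltW.
  by rewrite lerBrDr gerDl leNgt invr_gt0 ltr0n.
Qed.

End FromDedekindArchimedean.

(** * Embedding an Archimedean field into the reals by rational cuts *)

Section RealEmbedding.
Variables (K : realFieldType) (archiK : Num.archimedean_axiom K) (R : realType).

(** Strict comparisons in [K] yield only weak ones in [R], which is easier to establish; density of
    the rationals recovers strictness and uniqueness. *)
Definition same_cut (x : K) (z : R) : Prop :=
  (forall q : rat, ratr q < x -> ratr q <= z) /\
  (forall q : rat, x < ratr q -> z <= ratr q).

Lemma same_cut_lt (x y : K) (z w : R) :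
  same_cut x z -> same_cut y w -> x < y -> z < w.
Proof.
move=> [_ xz] [yw _] xy; have [q /andP[xq qy]] := archi_rat_dense archiK xy.
have [q' /andP[qq' q'y]] := archi_rat_dense archiK qy.
rewrite (le_lt_trans (xz q xq))// (lt_le_trans _ (yw q' q'y))// ltr_rat.
by rewrite ltr_rat in qq'.
Qed.

(** Given rationals [q < q'] strictly between [z] and [w], either [x < q'], contradicting the cut of
    [w], or [q < x], contradicting that of [z]. *)
Lemma same_cut_inj (x : K) (z w : R) : same_cut x z -> same_cut x w -> z = w.
Proof.
wlog zw : z w / z < w => [H xz xw|[xz _] [_ xw]].
  by have [zw|zw|//] := ltgtP z w; [exact: H|apply/esym; exact: H].
have [q] := rat_in_itvoo zw; rewrite in_itv /= => /andP[zq qw].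
have [q'] := rat_in_itvoo qw; rewrite in_itv /= => /andP[].
rewrite ltr_rat => qq' q'w; have [xq|qx] := ltP x (ratr q').
  by have := xw _ xq; rewrite leNgt q'w.
have : ratr q < x by rewrite (lt_le_trans _ qx)// ltr_rat.
by move=> /xz; rewrite leNgt zq.
Qed.

Lemma same_cut_exists (x : K) : exists z, same_cut x z.
Proof.
pose A := [set (ratr q : R) | q in [set q | ratr q < x]].
have Aub q : x < ratr q -> ubound A (ratr q).
  by move=> xq _ [q' /= q'x <-]; rewrite ler_rat -(ler_rat K) ltW//
     (lt_trans q'x).
have A0 : A !=set0.
  have [|q /andP[_ qx]] := @archi_rat_dense _ archiK (x - 1) x; first lra.
  by exists (ratr q), q.
have [|q0 /andP[xq0 _]] := @archi_rat_dense _ archiK x (x + 1); first lra.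
exists (sup A); split=> q qx; last by apply: ge_sup => //; exact: Aub.
apply: ub_le_sup; first by exists (ratr q0); exact: Aub.
by exists q.
Qed.

Lemma same_cut_rat (q : rat) : same_cut (ratr q) (ratr q).
Proof. by split=> q'; rewrite ltr_rat ler_rat => /ltW. Qed.

Lemma same_cutN (x : K) (z : R) : same_cut x z -> same_cut (- x) (- z).
Proof.
move=> [xz zx]; split=> q qx.
  by rewrite lerNr -rmorphN zx// rmorphN ltrNr.
by rewrite lerNl -rmorphN xz// rmorphN ltrNl.
Qed.

(** A rational [q] on one side of [x + y] splits as [q1 + (q - q1)], with the summands on that side
    of [x] and of [y]. *)
Lemma same_cutD (x y : K) (z w : R) :
  same_cut x z -> same_cut y w -> same_cut (x + y) (z + w).
Proof.
move=> [xz zx] [yw wy]; split=> q qxy.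
- have [|q1 /andP[q1y q1x]] := @archi_rat_dense _ archiK (ratr q - y) x; first lra.
  rewrite -(subrKC q1 q) rmorphD lerD ?xz ?yw// rmorphB; lra.
- have [|q1 /andP[q1x q1y]] := @archi_rat_dense _ archiK x (ratr q - y); first lra.
  rewrite -(subrKC q1 q) rmorphD lerD ?zx ?wy// rmorphB; lra.
Qed.

Lemma same_cut0 : same_cut 0 0.
Proof. by have := same_cut_rat 0; rewrite !rmorph0. Qed.

(** The multiplicative analogue: [q] splits as [q1 * (q / q1)] with [q1] positive, and a nonpositive
    [q] is below [z * w] by sign. *)
Lemma same_cutM_gt0 (x y : K) (z w : R) : 0 < x -> 0 < y ->
  same_cut x z -> same_cut y w -> same_cut (x * y) (z * w).
Proof.
move=> x0 y0 xzP ywP.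
have z0 := same_cut_lt same_cut0 xzP x0; have w0 := same_cut_lt same_cut0 ywP y0.
have [xz zx] := xzP; have [yw wy] := ywP; split=> q qxy.
- have [q0|q0] := leP q 0.
    by rewrite (@le_trans _ _ 0)// ?lerq0// mulr_ge0 ?ltW.
  have [|q1 /andP[q1y q1x]] := @archi_rat_dense _ archiK (ratr q / y) x.
    by rewrite ltr_pdivrMr.
  have q1_gt0 : 0 < q1 by rewrite -(ltr0q K) (lt_trans _ q1y)// divr_gt0// ltr0q.
  rewrite -(mulfVK (lt0r_neq0 q1_gt0) q) rmorphM mulrC.
  apply: ler_pM; rewrite ?ler0q ?divr_ge0 ?(ltW q1_gt0) ?(ltW q0)//.
    exact: xz.
  apply: yw; rewrite fmorph_div ltr_pdivrMr ?ltr0q//.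
  by rewrite mulrC -ltr_pdivrMr.
- have [|q1 /andP[q1x q1y]] := @archi_rat_dense _ archiK x (ratr q / y).
    by rewrite ltr_pdivlMr.
  have q1_gt0 : 0 < q1 by rewrite -(ltr0q K) (lt_trans x0).
  rewrite -(mulfVK (lt0r_neq0 q1_gt0) q) rmorphM [leRHS]mulrC.
  apply: ler_pM; rewrite ?(ltW z0) ?(ltW w0)//; first exact: zx.
  apply: wy; rewrite fmorph_div ltr_pdivlMr ?ltr0q//.
  by rewrite mulrC -ltr_pdivlMr.
Qed.

Lemma same_cutM (x y : K) (z w : R) :
  same_cut x z -> same_cut y w -> same_cut (x * y) (z * w).
Proof.
have cut0 u v : same_cut u v -> u = 0 -> v = 0.
  by move=> uv u0; apply: (same_cut_inj uv); rewrite u0; exact: same_cut0.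
wlog x0 : x z / 0 < x => [H xz yw|xz].
  have [x0|x0|x0] := ltgtP x 0; [|exact: H|].
    rewrite -[x * y]opprK -[z * w]opprK -mulNr -[- (z * w)]mulNr.
    apply: same_cutN.
    apply: H => //; first lra.
    exact: same_cutN.
  by rewrite (cut0 _ _ xz x0) x0 !mul0r; exact: same_cut0.
move=> yw; have [y0|y0|y0] := ltgtP y 0; last 2 first.
- exact: same_cutM_gt0.
- by rewrite (cut0 _ _ yw y0) y0 !mulr0; exact: same_cut0.
rewrite -[x * y]opprK -[z * w]opprK -mulrN -[- (z * w)]mulrN; apply: same_cutN.
by apply: same_cutM_gt0 => //; [lra|exact: same_cutN].
Qed.

Lemma hilbert_dedekind : hilbert_complete K -> dedekind_complete K.
Proof.
move=> hK; have [f fP] := choice same_cut_exists.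
have f_zmod : zmod_morphism f.
  (* Uniqueness of the real with a given cut turns the cut rules into morphism laws. *)
  move=> x y; apply: (same_cut_inj (fP _)).
  by apply: same_cutD => //; exact: same_cutN.
have f_monoid : monoid_morphism f.
  split=> [|x y]; apply: (same_cut_inj (fP _)); last exact: same_cutM.
  by have := same_cut_rat 1; rewrite !rmorph1.
pose F : {rmorphism K -> R} := HB.pack f
  (GRing.isZmodMorphism.Build _ _ f f_zmod)
  (GRing.isMonoidMorphism.Build _ _ f f_monoid).
have f_mono : {mono f : x y / x <= y}.
  by apply: le_mono => x y; exact: same_cut_lt.
(* A missed real would make [R] a proper Archimedean extension; by surjectivity, suprema in [R] pull
   back to [K]. *)
have f_surj z : exists x, f x = z.
  apply: contrapT => h; apply: hK; exists R, F; split=> //.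
    by move=> r; exists (Num.bound `|r|); rewrite archi_boundP.
  by exists z => x; apply/eqP => fx; apply: h; exists x.
move=> A [a Aa] [b bA]; have [s fs] := f_surj (sup (f @` A)).
have fAub : has_ubound (f @` A).
  by exists (f b) => _ [x Ax <-]; rewrite f_mono; exact: bA.
exists s; split=> [x Ax|c cA]; rewrite -f_mono fs.
  by apply: ub_le_sup => //; exists x.
apply: ge_sup; first by exists (f a), a.
by move=> _ [x Ax <-]; rewrite f_mono; exact: cA.
Qed.

End RealEmbedding.

Theorem theorem4p1 (K : realFieldType) (archiK : Num.archimedean_axiom K)
    (U : set_system nat) (UU : UltraFilter U) (freeU : free_filter U) :
  [<-> (forall kappa : Type, infinite_set [set: kappa]%classic ->
          cantor_card_complete K kappa);
       leibniz_complete K UU;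
       heine_borel_complete K;
       monotone_complete K;
       cantor_complete K;
       weierstrass_complete K;
       bolzano_complete K;
       cauchy_complete K;
       dedekind_complete K;
       hilbert_complete K].
Proof.
(* The implications form one cycle in the order of the list, passing through Dedekind completeness
   at each stage. *)
tfae.
- by move=> /(cantor_card_dedekind archiK) dedK; exact: dedekind_leibniz.
- by move=> /(leibniz_dedekind archiK freeU); exact: dedekind_heine_borel.
- by move=> /(heine_borel_dedekind archiK); exact: dedekind_monotone.
- by move=> /(monotone_dedekind archiK); exact: dedekind_cantor.
- by move=> /(cantor_dedekind archiK); exact: dedekind_weierstrass.
- by move=> /(weierstrass_dedekind archiK); exact: dedekind_bolzano.
- by move=> /(bolzano_dedekind archiK); exact: dedekind_cauchy.
- exact: cauchy_dedekind.
- exact: dedekind_hilbert.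
- move=> /(hilbert_dedekind archiK Rdefinitions.R) dedK kappa _.
  exact: dedekind_cantor_card.
Qed.
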